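(* Consider the noise-free nonlinear system $x_{t+1}=f_t(x_t)$, $y_t=C_tx_t$ ($t\in\mathbb{N}$) with $f_t:\mathbb{R}^n\to\mathbb{R}^n$ and $C_t\in\mathbb{R}^{n_y\times n}$, and the estimator defined, from an initial estimate $\hat{x}_0\in\mathbb{R}^n$, for $t\ge1$ by $$\hat{x}_{t|t-1}=f_{t-1}(\hat{x}_{t-1}),$$ $$\hat{x}_t=\operatorname*{arg\,min}_{z\in\mathbb{R}^n}\Big[\tfrac12\big\|W_t^{-1}(z-\hat{x}_{t|t-1})\big\|_2^2+\psi\big(V_t^{-1}(y_t-C_tz)\big)\Big].$$ Assume the following. 1. $\psi:\mathbb{R}^{n_y}\to\mathbb{R}_+$ is convex, continuous and positive definite. 2. The matrices $W_t\in\mathbb{R}^{n\times n}$, $V_t\in\mathbb{R}^{n_y\times n_y}$ are symmetric positive definite and there are positive real numbers $a_w,b_w,a_v,b_v$ such that $a_wI\preceq W_t\preceq b_wI$ and $a_vI\preceq V_t\preceq b_vI$ for all $t$. 3. Each $f_t$ is globally Lipschitz: for all $t\in\mathbb{N}$ there is $L_t\ge0$ such that $\|f_t(x)-f_t(x')\|_2\le L_t\|x-x'\|_2$ for all $x,x'\in\mathbb{R}^n$. 4. There exist a fixed $T\in\mathbb{N}$ and a nondecreasing and positive definite function $\alpha_0:\mathbb{R}_+\to\mathbb{R}_+$ such that $\widetilde\Sigma_t(e)\ge\alpha_0(\|e\|)$ for all $t\ge T$ and all $e\in\mathbb{R}^n$, where $\widetilde\Sigma_t(e)$ is the quantity defined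 in the context. 5. For all $t\ge1$ and all $e\in\mathbb{R}^n$, $\widetilde D_t(e)\le0$, where $$\widetilde D_t(e)=e^\top\big(a_w^{-2}L_{t-1}^2I_n-W_{t-1}^{-2}\big)e-2\psi\big(V_{t-1}^{-1}C_{t-1}e\big).$$ Then the estimation error $e_t=\hat{x}_t-x_t$ satisfies $e_t\to0$ as $t\to\infty$.
   Context: $\|\cdot\|_2$ is the Euclidean norm, $\|\cdot\|$ is an arbitrary fixed vector norm, and $S_1\preceq S_2$ means that $S_2-S_1$ is positive semidefinite. A function is positive definite if it is nonnegative, vanishes at $0$, and is strictly positive elsewhere on its domain. The subdifferential of $f:\mathbb{R}^n\to\mathbb{R}$ at $x$ is $\partial f(x)=\{g: f(y)-f(x)\ge g^\top(y-x)\ \forall y\in\mathbb{R}^n\}$. Definition of $\widetilde\Sigma_t$. Let $(x_t)$ be the true state trajectory, $g_k(z)=\psi(V_k^{-1}(y_k-C_kz))$, and $d_{k}(e)=f_{k}(x_{k}+e)-f_{k}(x_{k})$. For $t\ge T$ and $e\in\mathbb{R}^n$, $$\widetilde\Sigma_t(e)=\sum_{k=t-T}^{t-1}\xi_k^\top W_k^2\,\xi_k,$$ where $e_{t-T}=e$, $\xi_k\in\partial g_k(x_k+e_k)$ for $k=t-T,\dots,t-1$, and $e_k=d_{k-1}(e_{k-1})-W_k^2\xi_k$ for $k=t-T+1,\dots,t-1$. (For $k\ge t-T+1$, $\xi_k$ and $e_k$ are uniquely determined by $e_{k-1}$.) The inequality $\widetilde\Sigma_t(e)\ge\alpha_0(\|e\|)$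 is understood for every admissible choice of the initial subgradient $\xi_{t-T}\in\partial g_{t-T}(x_{t-T}+e)$. *)

(* Defs.v *)
From mathcomp Require Import all_boot all_order all_algebra.
From mathcomp Require Import boolp classical_sets reals topology normedtype.
From mathcomp Require Import convex.

Set Implicit Arguments.
Unset Strict Implicit.
Unset Printing Implicit Defensive.

Import Order.TTheory GRing.Theory Num.Theory.
Import numFieldNormedType.Exports.

Local Open Scope classical_set_scope.
Local Open Scope ring_scope.

Definition dotv (R : realType) (n : nat) (u v : 'cV[R]_n) : R :=
  (u^T *m v) 0 0.

Definition qform (R : realType) (n : nat) (S : 'M[R]_n) (u : 'cV[R]_n) : R :=
  (u^T *m S *m u) 0 0.

(* The library norm on 'cV[R]_n is the max norm, hence this definition. *)
Definition enorm (R : realType) (n : nat) (u : 'cV[R]_n) : R :=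
  Num.sqrt (\sum_i u i 0 ^+ 2).

Definition vector_norm (R : realType) (n : nat) (N : 'cV[R]_n -> R) : Prop :=
  [/\ forall u v, N (u + v) <= N u + N v,
      forall (a : R) u, N (a *: u) = `|a| * N u
    & forall u, N u = 0 -> u = 0].

Definition sym_psd (R : realType) (n : nat) (S : 'M[R]_n) : Prop :=
  S^T = S /\ forall u, 0 <= qform S u.

Definition sym_pd (R : realType) (n : nat) (S : 'M[R]_n) : Prop :=
  S^T = S /\ forall u, u != 0 -> 0 < qform S u.

Definition loewner_le (R : realType) (n : nat) (S1 S2 : 'M[R]_n) : Prop :=
  sym_psd (S2 - S1).

(* A function f on the subset D of U (with 0 in D) is represented by a total
   function whose values outside D are irrelevant. *)
Definition pos_def_on (R : realType) (U : zmodType) (D : set U) (f : U -> R)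
    : Prop :=
  [/\ forall u, D u -> 0 <= f u,
      f 0 = 0
    & forall u, D u -> u != 0 -> 0 < f u].

Definition subdiff (R : realType) (n : nat) (f : 'cV[R]_n -> R) (x : 'cV[R]_n)
    : set 'cV[R]_n :=
  [set g | forall y, dotv g (y - x) <= f y - f x].

Definition argmin (R : realType) (U : Type) (F : U -> R) : set U :=
  [set u | forall z, F u <= F z].

Definition out_loss (R : realType) (n p : nat) (psi : 'cV[R]_p -> R)
    (V : nat -> 'M[R]_p) (C : nat -> 'M[R]_(p, n)) (y : nat -> 'cV[R]_p)
    (k : nat) (z : 'cV[R]_n) : R :=
  psi (invmx (V k) *m (y k - C k *m z)).

(* xp is the one-step prediction at time t. *)
Definition est_cost (R : realType) (n p : nat) (psi : 'cV[R]_p -> R)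
    (W : nat -> 'M[R]_n) (V : nat -> 'M[R]_p) (C : nat -> 'M[R]_(p, n))
    (y : nat -> 'cV[R]_p) (t : nat) (xp z : 'cV[R]_n) : R :=
  2^-1 * enorm (invmx (W t) *m (z - xp)) ^+ 2 + out_loss psi V C y t z.

Definition err_step (R : realType) (n : nat) (f : nat -> 'cV[R]_n -> 'cV[R]_n)
    (x : nat -> 'cV[R]_n) (k : nat) (e : 'cV[R]_n) : 'cV[R]_n :=
  f k (x k + e) - f k (x k).

(* The last clause is the first-order optimality condition of est_cost in terms
   of the estimation error.  The values of ee and xi at indices k outside
   t - T <= k < t are irrelevant. *)
Definition err_path (R : realType) (n p : nat) (psi : 'cV[R]_p -> R)
    (W : nat -> 'M[R]_n) (V : nat -> 'M[R]_p) (C : nat -> 'M[R]_(p, n))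
    (f : nat -> 'cV[R]_n -> 'cV[R]_n) (x : nat -> 'cV[R]_n)
    (y : nat -> 'cV[R]_p) (T t : nat) (e : 'cV[R]_n)
    (ee xi : nat -> 'cV[R]_n) : Prop :=
  [/\ ee (t - T)%N = e,
      forall k, (t - T <= k < t)%N ->
        subdiff (out_loss psi V C y k) (x k + ee k) (xi k)
    & forall k, (t - T < k < t)%N ->
        ee k = err_step f x k.-1 (ee k.-1) - W k ^+ 2 *m xi k].

(* The sum depends on the choice of the subgradient xi (t - T); this is the set
   of its values over all admissible choices. *)
Definition Sigma_tilde (R : realType) (n p : nat) (psi : 'cV[R]_p -> R)
    (W : nat -> 'M[R]_n) (V : nat -> 'M[R]_p) (C : nat -> 'M[R]_(p, n))
    (f : nat -> 'cV[R]_n -> 'cV[R]_n) (x : nat -> 'cV[R]_n)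
    (y : nat -> 'cV[R]_p) (T t : nat) (e : 'cV[R]_n) : set R :=
  [set s | exists ee xi : nat -> 'cV[R]_n,
     err_path psi W V C f x y T t e ee xi /\
     s = \sum_(t - T <= k < t) qform (W k ^+ 2) (xi k)].

(* Meant for t >= 1 only: 0.-1 = 0. *)
Definition D_tilde (R : realType) (n p : nat) (psi : 'cV[R]_p -> R)
    (W : nat -> 'M[R]_n) (V : nat -> 'M[R]_p) (C : nat -> 'M[R]_(p, n))
    (L : nat -> R) (aw : R) (t : nat) (e : 'cV[R]_n) : R :=
  qform ((aw ^- 2 * L t.-1 ^+ 2)%:M - invmx (W t.-1) ^+ 2) e
  - 2 * psi (invmx (V t.-1) *m (C t.-1 *m e)).

(* Main.v *)
Require Import Defs.
From mathcomp Require Import all_boot all_order all_algebra.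
From mathcomp Require Import boolp classical_sets reals topology normedtype.
From mathcomp Require Import convex.
From mathcomp Require Import interval_inference sequences derive lra.

Import Order.TTheory GRing.Theory Num.Theory.
Import numFieldNormedType.Exports.

Local Open Scope classical_set_scope.
Local Open Scope ring_scope.

(** Write [e t] for the estimation error. Stationarity of the update says that
    [xi t = W_t^-2 (xpred t - xhat t)] is a subgradient of the output loss at
    [xhat t] ([argmin_subdiff]), so the error obeys the recursion that defines
    the window sums [Sigma_tilde], and along it the update is a proximal step.

    The proof is a Lyapunov argument for
      [U t = |W_t^-1 e_t|^2 + 2 psi (- V_t^-1 C_t e_t)].
    The energy balance of the proximal step ([proximal_energy]), together with
    [xi t . e t >= psi (- V_t^-1 C_t e_t)], which is the subgradient inequality
    tested at the true state, bounds [U t + xi_t^T W_t^2 xi_t] by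
    [|W_t^-1 d|^2] with [d] the propagated error. The lower bound on [W_t]
    ([loewner_le_invmx]) and the Lipschitz bound turn this into
    [aw^-2 L^2 |e_(t-1)|^2], and the hypothesis on [D_tilde] at [- e_(t-1)] is
    exactly what makes that at most [U (t-1)]. The loss is included in [U]
    because it is produced at time [t] but consumed by [D_tilde] at time
    [t+1].

    Hence [U] is nonincreasing and bounded below, so its decrease over windows
    of the fixed length [T] tends to [0]. This decrease bounds the window sum,
    hence [alpha0 (N (e t))]; monotonicity and positivity of [alpha0] then give
    [N (e t) --> 0], and a lower bound of [N] by the max norm
    ([vector_norm_ge]) concludes. *)

(** * Inner product and quadratic forms *)

Section InnerProduct.
Set Implicit Arguments.
Unset Strict Implicit.
Context {R : realType}.

Lemma dotvC n (u v : 'cV[R]_n) : dotv u v = dotv v u.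
Proof.
by rewrite /dotv !mxE; apply: eq_bigr => i _; rewrite !mxE mulrC.
Qed.

Lemma dotvDr n (u v w : 'cV[R]_n) : dotv u (v + w) = dotv u v + dotv u w.
Proof. by rewrite /dotv mulmxDr mxE. Qed.

Lemma dotvDl n (u v w : 'cV[R]_n) : dotv (v + w) u = dotv v u + dotv w u.
Proof. by rewrite dotvC dotvDr !(dotvC u). Qed.

Lemma dotvZr n (a : R) (u v : 'cV[R]_n) : dotv u (a *: v) = a * dotv u v.
Proof. by rewrite /dotv -scalemxAr mxE. Qed.

Lemma dotvZl n (a : R) (u v : 'cV[R]_n) : dotv (a *: u) v = a * dotv u v.
Proof. by rewrite dotvC dotvZr dotvC. Qed.

Lemma dotvNr n (u v : 'cV[R]_n) : dotv u (- v) = - dotv u v.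
Proof. by rewrite -scaleN1r dotvZr mulN1r. Qed.

Lemma dotvNl n (u v : 'cV[R]_n) : dotv (- u) v = - dotv u v.
Proof. by rewrite dotvC dotvNr dotvC. Qed.

Lemma dotv_mulmxl m n (A : 'M[R]_(m, n)) (u : 'cV[R]_n) (v : 'cV[R]_m) :
  dotv (A *m u) v = dotv u (A^T *m v).
Proof. by rewrite /dotv trmx_mul mulmxA. Qed.

Lemma enorm_sqr n (u : 'cV[R]_n) : enorm u ^+ 2 = dotv u u.
Proof.
rewrite sqr_sqrtr; last by apply: sumr_ge0 => i _; exact: sqr_ge0.
by rewrite /dotv mxE; apply: eq_bigr => i _; rewrite mxE expr2.
Qed.

Lemma dotv_ge0 n (u : 'cV[R]_n) : 0 <= dotv u u.
Proof. by rewrite -enorm_sqr sqr_ge0. Qed.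

Lemma enorm_ge0 n (u : 'cV[R]_n) : 0 <= enorm u.
Proof. exact: sqrtr_ge0. Qed.

Lemma qformE n (S : 'M[R]_n) u : qform S u = dotv u (S *m u).
Proof. by rewrite /qform /dotv mulmxA. Qed.

Lemma qform_sqr n (S : 'M[R]_n) u :
  S^T = S -> qform (S ^+ 2) u = dotv (S *m u) (S *m u).
Proof. by move=> SS; rewrite qformE dotv_mulmxl SS mulmxA. Qed.

Lemma qformBl n (S1 S2 : 'M[R]_n) u :
  qform (S1 - S2) u = qform S1 u - qform S2 u.
Proof. by rewrite /qform mulmxBr mulmxBl !mxE. Qed.

Lemma qform_scalar n (a : R) (u : 'cV[R]_n) : qform a%:M u = a * dotv u u.
Proof. by rewrite qformE mul_scalar_mx dotvZr. Qed.

(** A kernel vector would make the quadratic form vanish. *)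
Lemma sym_pd_unitmx n (S : 'M[R]_n) : sym_pd S -> S \in unitmx.
Proof.
case=> SS Spos; rewrite unitmxE unitfE; apply/det0P => -[v v0 vS].
have /Spos : v^T != 0 by rewrite -[0]trmx0 (inj_eq trmx_inj).
by rewrite /qform trmxK vS mul0mx mxE ltxx.
Qed.

Lemma invmx_sym n (S : 'M[R]_n) : S^T = S -> (invmx S)^T = invmx S.
Proof. by move=> SS; rewrite trmx_inv SS. Qed.

(** With [u] the image of [d] under the inverse of [S], the bound follows from
    [0 <= |d - a u|^2] and [a |u|^2 <= u . S u = u . d]. *)
Lemma loewner_le_invmx n (a : R) (S : 'M[R]_n) (d : 'cV[R]_n) :
  0 < a -> sym_pd S -> loewner_le a%:M S ->
  dotv (invmx S *m d) (invmx S *m d) <= a ^- 2 * dotv d d.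
Proof.
move=> a0 Spd [_ Sa]; set u := invmx S *m d.
have Su : S *m u = d by rewrite mulKVmx// sym_pd_unitmx.
have := Sa u; rewrite qformBl qform_scalar qformE Su => au.
have := dotv_ge0 (d - a *: u).
rewrite dotvDl !dotvDr !dotvNl !dotvNr !dotvZl !dotvZr (dotvC d u) => h.
rewrite -ler_pdivrMl ?invr_gt0 ?exprn_gt0// invrK.
nra.
Qed.

End InnerProduct.

(** * Optimality and energy balance of a proximal step *)

Section ProximalStep.
Set Implicit Arguments.
Unset Strict Implicit.
Context {R : realType}.

Lemma out_loss_convex n p (psi : 'cV[R]_p -> R) V (C : nat -> 'M[R]_(p, n))
    y k :
  convex_function setT psi -> convex_function setT (out_loss psi V C y k).
Proof.
move=> cpsi t a b _ _; rewrite /out_loss.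
apply: le_trans (cpsi t _ _ (in_setT _) (in_setT _)).
rewrite le_eqVlt; apply/orP; left; apply/eqP; congr psi.
rewrite /conv/= /unstable.onem.
move: (t%:num) => s; move: {t} a b => a b; rewrite !scalemxAr -mulmxDr.
congr (_ *m _).
rewrite (mulmxDr (C k) (s *: a : 'cV_n)) -(scalemxAr s) -(scalemxAr (1 - s)).
rewrite !scalerBr addrACA -opprD -scalerDl; congr (_ - _).
by rewrite addrC subrK scale1r.
Qed.

(** Fermat's rule for a smooth quadratic plus a merely convex term:
    compare the minimiser [z] with points [z + s (w - z)], divide by [s] and
    let [s] tend to [0]. *)
Lemma argmin_subdiff n (M : 'M[R]_n) (g : 'cV[R]_n -> R) (xp z : 'cV[R]_n) :
  convex_function setT g ->
  argmin (fun w => 2^-1 * enorm (M *m (w - xp)) ^+ 2 + g w) z ->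
  subdiff g z (M^T *m (M *m (xp - z))).
Proof.
move=> cg zmin w.
set b := M *m (w - z); set a := M *m (z - xp).
have -> : dotv (M^T *m (M *m (xp - z))) (w - z) = - dotv a b.
  by rewrite dotv_mulmxl trmxK -/b -opprB mulmxN dotvNl.
rewrite -subr_ge0 opprK; apply/ler_addgt0Pr => e e0.
set q := dotv b b; have q0 : 0 <= q := dotv_ge0 _.
(* This step length lies in (0, 1] and keeps the second-order term below e. *)
pose s := e / (e + q).
have eq0 : 0 < e + q by lra.
have s0 : 0 < s by rewrite divr_gt0.
have s1 : s <= 1 by rewrite ler_pdivrMr// mul1r; lra.
have se : s * (e + q) = e by rewrite divfK// gt_eqF.
pose t : {i01 R} := Itv01 (ltW s0) s1.
have := cg t w z (in_setT _) (in_setT _).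
rewrite convRE /conv/= /unstable.onem => gs.
have {gs} := le_trans (zmin _) (lerD (lexx _) gs).
rewrite (_ : M *m (s *: w + (1 - s) *: z - xp) = a + s *: b); last first.
  rewrite /a /b scalemxAr -mulmxDr /=; congr (_ *m _).
  rewrite scalerBl scale1r scalerBr addrCA [RHS]addrAC -addrA.
  by congr (_ + _); rewrite addrC addrA addrAC.
rewrite !enorm_sqr -/a dotvDl !dotvDr !dotvZl !dotvZr (dotvC b a) -/q.
set ab := dotv a b; set gw := g w; set gz := g z => h.
have {h} : 0 <= s * (gw - gz + ab + 2^-1 * (s * q)) by lra.
rewrite pmulr_rge0// => h.
have : s * q <= e by nra.
lra.
Qed.

(** Expanding the square of [W^-1 d = W^-1 e + W^-1 (d - e)]: for the
    subgradient [xi = W^-2 (d - e)], the cross term is [2 xi . e] and the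
    square of [W^-1 (d - e)] is [xi^T W^2 xi]. *)
Lemma proximal_energy n (W : 'M[R]_n) (e d : 'cV[R]_n) :
  sym_pd W ->
  let xi := invmx W *m (invmx W *m (d - e)) in
  dotv (invmx W *m e) (invmx W *m e) + 2 * dotv xi e + qform (W ^+ 2) xi
  = dotv (invmx W *m d) (invmx W *m d).
Proof.
move=> Wpd /=; have [WT _] := Wpd; have Wu := sym_pd_unitmx Wpd.
rewrite qform_sqr// mulKVmx//.
set A := invmx W *m e; set B := invmx W *m (d - e).
have -> : invmx W *m d = A + B by rewrite -mulmxDr addrC subrK.
rewrite (dotv_mulmxl _ B) invmx_sym// -/A.
rewrite dotvDl !dotvDr (dotvC A B); lra.
Qed.

End ProximalStep.

(** * Comparison of an arbitrary norm with the max norm *)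

Section NormEquivalence.
Set Implicit Arguments.
Unset Strict Implicit.
Context {R : realType}.

Lemma vector_norm0 n (N : 'cV[R]_n -> R) : vector_norm N -> N 0 = 0.
Proof. by case=> _ NZ _; rewrite -(scale0r 0) NZ normr0 mul0r. Qed.

Lemma vector_normN n (N : 'cV[R]_n -> R) u : vector_norm N -> N (- u) = N u.
Proof. by case=> _ NZ _; rewrite -scaleN1r NZ normrN1 mul1r. Qed.

Lemma vector_norm_ge0 n (N : 'cV[R]_n -> R) u : vector_norm N -> 0 <= N u.
Proof.
move=> NN; have [ND _ _] := NN.
have := ND u (- u); rewrite subrr vector_norm0// vector_normN//; lra.
Qed.

Lemma vector_norm_dist n (N : 'cV[R]_n -> R) u v :
  vector_norm N -> `|N u - N v| <= N (u - v).
Proof.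
move=> NN; have [ND _ _] := NN; rewrite ler_norml.
have := ND (u - v) v; have := ND (v - u) u; rewrite !subrK.
rewrite -opprB vector_normN// => h1 h2; apply/andP; split; lra.
Qed.

Lemma mx_entry_le_norm m n (A : 'M[R]_(m, n)) i j : `|A i j| <= `|A|.
Proof.
rewrite [leRHS]/Num.norm /= mx_normrE.
by apply: le_trans (le_bigmax _ _ (i, j)).
Qed.

Lemma normr_trmx m n (A : 'M[R]_(m, n)) : `|A^T| = `|A|.
Proof.
have le k l (B : 'M[R]_(k, l)) : `|B^T| <= `|B|.
  rewrite [leLHS]/Num.norm /= mx_normrE.
  apply/bigmax_leP; split=> // -[i j] _ /=.
  by rewrite mxE mx_entry_le_norm.
by apply/eqP; rewrite eq_le le /= -{1}(trmxK A) le.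
Qed.

(** Expand [u] in the standard basis; the added [1] only makes the constant
    positive in dimension [0]. *)
Lemma vector_norm_le n (N : 'cV[R]_n -> R) : vector_norm N ->
  exists2 K, 0 < K & forall u, N u <= K * `|u|.
Proof.
move=> NN; have [ND NZ _] := NN.
have S0 : 0 <= \sum_i N (delta_mx i 0).
  by apply: sumr_ge0 => i _; exact: vector_norm_ge0.
exists (1 + \sum_i N (delta_mx i 0)) => [|u]; first lra.
apply: (@le_trans _ _ (\sum_i `|u i 0| * N (delta_mx i 0))).
  rewrite {1}(matrix_sum_delta u) -[X in X <= _]/(N _).
  under [X in N X]eq_bigr do rewrite big_ord1.
  elim/big_ind2 : _ => [|x1 x2 y1 y2 h1 h2|i _]; first by rewrite vector_norm0.
    exact: le_trans (ND _ _) (lerD h1 h2).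
  by rewrite NZ.
rewrite mulrDl mul1r mulr_suml -[leLHS]add0r lerD//.
apply: ler_sum => i _; rewrite mulrC ler_wpM2l ?vector_norm_ge0//.
exact: mx_entry_le_norm.
Qed.

Lemma vector_norm_continuous n (N : 'cV[R]_n -> R) :
  vector_norm N -> continuous (fun v : 'rV[R]_n => N v^T).
Proof.
move=> NN v; have [K K0 NK] := vector_norm_le NN.
apply/(@cvgrPdist_lt _ _ _ (nbhs v)) => e e0; apply/nbhs_ballP.
exists (e / K) => [|w]; first by rewrite /= divr_gt0.
rewrite mx_norm_ball /ball_ /= => vw.
apply: le_lt_trans (vector_norm_dist _ _ NN) _.
apply: le_lt_trans (NK _) _.
by rewrite -linearB /= normr_trmx mulrC -ltr_pdivlMr.
Qed.

(** The minimum of [N] on the compact unit sphere of the max norm is positive.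
    Transposing to row vectors gives access to [bounded_closed_compact]. *)
Lemma vector_norm_ge n (N : 'cV[R]_n -> R) : vector_norm N ->
  exists2 c, 0 < c & forall u, c * `|u| <= N u.
Proof.
move=> NN; have [_ NZ N0] := NN.
pose S := [set v : 'rV[R]_n | `|v| = 1].
have SP u : u != 0 -> S (`|u|^-1 *: u^T).
  move=> u0; rewrite /S /= normrZ normr_trmx normfV normr_id mulVf//.
  by rewrite normr_eq0.
have [S0|S0] := pselect (S !=set0); last first.
  (* The sphere is empty only in dimension 0, where every vector is 0. *)
  exists 1 => // u; have [->|/SP Su] := eqVneq u 0.
    by rewrite normr0 mulr0 vector_norm0.
  by case: S0; eexists; exact: Su.
have Sc : compact S.
  apply: bounded_closed_compact.
    by exists 1; split=> // M M1 v /= ->; exact: ltW.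
  have -> : S = Num.norm @^-1` [set 1 : R] by [].
  apply: closed_comp => [v _|]; first exact: norm_continuous.
  exact: closed_eq.
have [|v vS vmin] := compact_EVT_min S0 Sc (f := fun v => N v^T).
  exact/continuous_subspaceT/vector_norm_continuous.
exists (N v^T) => [|u].
  rewrite lt_neqAle vector_norm_ge0// andbT eq_sym.
  apply: contraPneq vS => /N0/(congr1 trmx); rewrite trmxK trmx0 => ->.
  by rewrite inE /S /= normr0 => /eqP; rewrite eq_sym oner_eq0.
have [->|u0] := eqVneq u 0; first by rewrite normr0 mulr0 vector_norm0.
have := vmin _ (mem_set (SP _ u0)).
rewrite linearZ /= trmxK NZ normfV normr_id mulrC ler_pdivlMr ?normr_gt0//.
Qed.

Lemma vector_norm_cvg0 n (N : 'cV[R]_n -> R) (u : nat -> 'cV[R]_n) :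
  vector_norm N -> (forall r, 0 < r -> \forall t \near \oo, N (u t) < r) ->
  u @ \oo --> (0 : 'cV[R]_n).
Proof.
move=> NN Nu; have [c c0 Nc] := vector_norm_ge NN.
apply/cvgr0Pnorm_lt => r r0.
have := Nu (c * r) (mulr_gt0 c0 r0); apply: filterS => t Nt.
by rewrite -(ltr_pM2l c0); exact: le_lt_trans Nt.
Qed.

End NormEquivalence.

Theorem theorem7 (R : realType) (n p : nat)
  (f : nat -> 'cV[R]_n -> 'cV[R]_n) (C : nat -> 'M[R]_(p, n))
  (x : nat -> 'cV[R]_n) (y : nat -> 'cV[R]_p)
  (psi : 'cV[R]_p -> R) (W : nat -> 'M[R]_n) (V : nat -> 'M[R]_p)
  (xpred xhat : nat -> 'cV[R]_n)
  (N : 'cV[R]_n -> R) (aw bw av bv : R) (L : nat -> R)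
  (T : nat) (alpha0 : R -> R)
  (state_eq : forall t, x t.+1 = f t (x t))
  (output_eq : forall t, y t = C t *m x t)
  (prediction : forall t, (1 <= t)%N -> xpred t = f t.-1 (xhat t.-1))
  (update : forall t, (1 <= t)%N ->
     argmin (est_cost psi W V C y t (xpred t)) (xhat t))
  (psi_convex : convex_function setT psi)
  (psi_continuous : continuous psi)
  (psi_pos_def : pos_def_on setT psi)
  (W_pd : forall t, sym_pd (W t))
  (V_pd : forall t, sym_pd (V t))
  (aw_gt0 : 0 < aw) (bw_gt0 : 0 < bw) (av_gt0 : 0 < av) (bv_gt0 : 0 < bv)
  (W_bounds : forall t, loewner_le aw%:M (W t) /\ loewner_le (W t) bw%:M)
  (V_bounds : forall t, loewner_le av%:M (V t) /\ loewner_le (V t) bv%:M)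
  (L_ge0 : forall t, 0 <= L t)
  (f_lipschitz : forall t u v, enorm (f t u - f t v) <= L t * enorm (u - v))
  (N_norm : vector_norm N)
  (alpha0_nondecreasing : forall r s, 0 <= r -> r <= s -> alpha0 r <= alpha0 s)
  (alpha0_pos_def : pos_def_on [set r : R | 0 <= r] alpha0)
  (Sigma_ge : forall t, (T <= t)%N -> forall e s,
     Sigma_tilde psi W V C f x y T t e s -> alpha0 (N e) <= s)
  (D_le0 : forall t, (1 <= t)%N -> forall e, D_tilde psi W V C L aw t e <= 0) :
  (fun t => xhat t - x t) @ \oo --> (0 : 'cV[R]_n).
Proof.
pose e t := xhat t - x t.
pose w t := invmx (W t).
pose xi t := w t *m (w t *m (xpred t - xhat t)).
pose g t := psi (invmx (V t) *m (C t *m (- e t))).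
pose U t := dotv (w t *m e t) (w t *m e t) + 2 * g t.
have [psi_ge0 psi0 _] := psi_pos_def.
have w_sym t : (w t)^T = w t by have [WT _] := W_pd t; exact: invmx_sym.
have xe t : x t + e t = xhat t by rewrite addrC subrK.
have xi_sub t : (1 <= t)%N -> subdiff (out_loss psi V C y t) (xhat t) (xi t).
  move=> t1; rewrite /xi -{1}w_sym; apply: argmin_subdiff.
    exact: out_loss_convex.
  exact: update.
have innov t : (1 <= t)%N ->
    xpred t - xhat t = err_step f x t.-1 (e t.-1) - e t.
  case: t => // t _; rewrite prediction//= /err_step xe /e -state_eq.
  by rewrite opprB addrA subrK.
have loss_e t : out_loss psi V C y t (xhat t) = g t.
  by rewrite /out_loss output_eq -mulmxBr -opprB.
have loss_x t : out_loss psi V C y t (x t) = 0.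
  by rewrite /out_loss output_eq subrr mulmx0 psi0.
(* Subgradient inequality at the true state, where the loss vanishes. *)
have xi_e t : (1 <= t)%N -> g t <= dotv (xi t) (e t).
  move=> /xi_sub /(_ (x t)); rewrite loss_e loss_x -opprB dotvNr -/(e t); lra.
have U_step t : U t.+1 + qform (W t.+1 ^+ 2) (xi t.+1) <= U t.
  set d := err_step f x t (e t).
  have := proximal_energy (e t.+1) d (W_pd t.+1).
  rewrite /= -(innov t.+1 isT) -/(w _) -/(xi _) => balance.
  have [Wa _] := W_bounds t.+1.
  have := loewner_le_invmx d aw_gt0 (W_pd _) Wa; rewrite -/(w _) => dW.
  have dL : dotv d d <= L t ^+ 2 * dotv (e t) (e t).
    rewrite -!enorm_sqr -exprMn ler_pXn2r ?nnegrE ?mulr_ge0 ?enorm_ge0//.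
    by have := f_lipschitz t (x t + e t) (x t); rewrite addrAC subrr add0r.
  have aw2 : 0 <= aw ^- 2 by rewrite invr_ge0 sqr_ge0.
  have := ler_wpM2l aw2 dL; rewrite mulrA => {}dL.
  (* The residual of the estimate is - V^-1 C e, hence the sign here. *)
  have := D_le0 t.+1 isT (- e t).
  rewrite /D_tilde /= qformBl qform_scalar -/(w t) -/(g t).
  rewrite (qform_sqr _ (w_sym t)) mulmxN !dotvNl !dotvNr !opprK => De.
  have := xi_e t.+1 isT; rewrite /U => xe1; lra.
have q_ge0 t : 0 <= qform (W t ^+ 2) (xi t).
  by have [WT _] := W_pd t; rewrite qform_sqr// dotv_ge0.
have U_noninc : nonincreasing_seq U.
  apply/nonincreasing_seqP => t; have := U_step t; have := q_ge0 t.+1; lra.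
have U_ge0 t : 0 <= U t by rewrite addr_ge0 ?dotv_ge0// mulr_ge0// psi_ge0.
have U_cvg : cvgn U.
  by apply: nonincreasing_is_cvgn => //; exists 0 => _ [t _ <-].
have U_sum m k : \sum_(m.+1 <= j < m.+1 + k) qform (W j ^+ 2) (xi j)
    <= U m - U (m + k)%N.
  elim: k => [|k IH]; first by rewrite !addn0 big_geq// subrr.
  rewrite addnS big_nat_recr ?leq_addr//= addSn addnS.
  have := U_step (m + k)%N; lra.
(* The actual errors form an admissible path. The window must start at a
   positive time, since no update fixes a subgradient at time 0. *)
have alphaU m : alpha0 (N (e m.+1)) <= U m - U (m + T)%N.
  apply: le_trans (U_sum m T).
  apply: (Sigma_ge (m.+1 + T)%N (leq_addl _ _) (e m.+1)).
  exists e, xi; rewrite addnK; split=> //; rewrite /err_path addnK; split=> //.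
    by move=> k /andP[mk _]; rewrite xe; apply: xi_sub; exact: leq_trans mk.
  move=> k /andP[mk _]; have k1 : (1 <= k)%N by exact: leq_trans (ltnW mk).
  have Wu := sym_pd_unitmx (W_pd k).
  by rewrite /xi expr2 -mulmxE -mulmxA !mulKVmx// innov// subKr.
have drop0 : (fun m => U m - U (m + T)%N) @ \oo --> (0 : R).
  rewrite -(subrr (limn U)); apply: cvgB => //.
  by rewrite (cvg_shiftn T U).
have [_ _ alpha_gt0] := alpha0_pos_def.
apply: (vector_norm_cvg0 N_norm) => // r r0.
have ar : 0 < alpha0 r by apply: alpha_gt0; rewrite /= ?ltW// gt_eqF.
have [M _ UM] := cvgr0_norm_lt _ drop0 _ ar.
exists M.+1 => // -[//|m] /UM Um; rewrite /= ltNge; apply/negP => rN.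
have := alpha0_nondecreasing _ _ (ltW r0) rN.
have := alphaU m; have := ler_norm (U m - U (m + T)%N); rewrite -/(e _); lra.
Qed.
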